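(* Let $p$ be an odd prime, $n\ge 1$, and let $f(x)=\sum_{i=1}^k a_i x^{p^{\alpha_i}+1}\in\mathbb F_{p^n}[x]$ with $k\ge 1$, integers $0\le\alpha_1<\cdots<\alpha_k=\alpha$, and $a_k\ne 0$. Let $b\in\mathbb F_{p^n}$. Then $$S(f+bx,n)=\begin{cases}\overline{e_n(f(x_0))}\,S(f,n)&\text{if } f^*(x)=b^{p^\alpha}\text{ has a solution }x_0\in\mathbb F_{p^n},\\ 0&\text{otherwise.}\end{cases}$$
   Context: $e_n(y)=e^{2\pi i\,\mathrm{Tr}_n(y)/p}$ for $y\in\mathbb F_{p^n}$, where $\mathrm{Tr}_n$ is the absolute trace $\mathbb F_{p^n}\to\mathbb F_p$. For $g\in\mathbb F_{p^n}[x]$, $S(g,n)=\sum_{x\in\mathbb F_{p^n}}e_n(g(x))$; in particular $S(f+bx,n)=\sum_{x\in\mathbb F_{p^n}}e_n(f(x)+bx)$. The polynomial $f^*$ is $$f^*(z)=\sum_{i=1}^k\left(a_i^{p^\alpha}z^{p^{\alpha+\alpha_i}}+a_i^{p^{\alpha-\alpha_i}}z^{p^{\alpha-\alpha_i}}\right).$$ *)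

(* Defs.v *)
From HB Require Import structures.
From mathcomp Require Import all_boot all_order all_algebra all_fingroup all_field.
From mathcomp Require Import reals trigo.
From mathcomp Require Import complex.

Set Implicit Arguments.
Unset Strict Implicit.
Unset Printing Implicit Defensive.

Import Order.TTheory GRing.Theory Num.Theory.
Local Open Scope ring_scope.

(* [pPrimeCharType charF] is F itself, seen as an extension of 'F_p.
   [galTrace] takes its values in F; they lie in the prime subfield (see
   [abs_traceE]), and the coordinate on the basis {1} reads them in 'F_p. *)
Definition abs_trace (F : finFieldType) (p : nat) (charF : p \in [pchar F])
    (y : F) : 'F_p :=
  let L := pPrimeCharType charF in
  coord [tuple (1 : L)] ord0 (galTrace 1%AS {:L} (y : L)).

Lemma abs_traceE (F : finFieldType) (p : nat) (charF : p \in [pchar F])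
    (y : F) :
  (abs_trace charF y)%:A
    = galTrace 1%AS {:pPrimeCharType charF} (y : pPrimeCharType charF).
Proof.
set L := pPrimeCharType charF.
have galL : galois 1%AS {:L} by apply: finField_galois; apply: sub1v.
have /= := mem_galTrace galL (memvf (y : L)).
move=> tr1; rewrite /abs_trace.
rewrite [RHS](@coord_span _ _ _ [tuple (1 : L)]) ?big_ord1 //.
by rewrite span_seq1.
Qed.

(* exp(2 i pi t / p) *)
Definition unit_exp (R : realType) (p t : nat) : R[i] :=
  let theta : R := 2 * pi * t%:R / p%:R in
  Complex (cos theta) (sin theta).

(* The coercion of an element of 'F_p to nat is its representative < p. *)
Definition add_char (R : realType) (F : finFieldType) (p : nat)
    (charF : p \in [pchar F]) (y : F) : R[i] :=
  unit_exp R p (abs_trace charF y).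

Definition weil_sum (R : realType) (F : finFieldType) (p : nat)
    (charF : p \in [pchar F]) (g : {poly F}) : R[i] :=
  \sum_(x : F) add_char R charF g.[x].

(* The k.+1 terms are indexed from 0, so that alpha_k is [alpha ord_max]. *)
Definition quad_poly (F : finFieldType) (p k : nat)
    (a : 'I_k.+1 -> F) (alpha : 'I_k.+1 -> nat) : {poly F} :=
  \sum_(i < k.+1) a i *: 'X^(p ^ alpha i + 1).

(* For increasing [alpha] the subtraction in nat is exact. *)
Definition quad_poly_star (F : finFieldType) (p k : nat)
    (a : 'I_k.+1 -> F) (alpha : 'I_k.+1 -> nat) : {poly F} :=
  let m := alpha ord_max in
  \sum_(i < k.+1)
    (a i ^+ (p ^ m) *: 'X^(p ^ (m + alpha i))
     + a i ^+ (p ^ (m - alpha i)) *: 'X^(p ^ (m - alpha i))).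

(* Main.v *)
(* Write q = p^alpha and psi for the additive character. Since Tr(y^p) = Tr(y),
   the polarization identity
     Tr f(x + y) = Tr f(x) + Tr f(y) + Tr(f*(x) y^q)
   holds, so the form Tr(f*(x) y^q) is symmetric. If f*(x0) = b^q, translating
   the sum S(f) by x0 gives S(f) = psi(f(x0)) S(f + bx). If f*(w) = 0 then
   Tr f(w) = 0 (as p is odd), and translating S = S(f + bx) by w gives
   S = psi(bw) S. By orthogonality of characters and the symmetry above, the
   number of solutions of f*(x) = b^q is the sum of psi(-bw) over the kernel of
   f*; multiplied by S it is S times the size of this kernel. Hence S = 0 if
   there is no solution. *)
Require Import Defs.
From HB Require Import structures.
From mathcomp Require Import all_boot all_order all_algebra all_fingroup all_field.
From mathcomp Require Import reals trigo.
From mathcomp Require Import complex ring.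

Set Implicit Arguments.
Unset Strict Implicit.
Unset Printing Implicit Defensive.

Import Order.TTheory GRing.Theory Num.Theory.
Local Open Scope ring_scope.

(** * Roots of unity of order dividing [p] *)

Lemma unit_expD (R : realType) (p s t : nat) :
  unit_exp R p (s + t) = unit_exp R p s * unit_exp R p t.
Proof.
rewrite /unit_exp natrD mulrDr mulrDl cosD sinD.
by apply/eqP; rewrite eq_complex /= eqxx /= addrC.
Qed.

Lemma unit_exp0 (R : realType) (p : nat) : unit_exp R p 0 = 1.
Proof. by rewrite /unit_exp mulr0 mul0r cos0 sin0. Qed.

Lemma unit_exp_period (R : realType) (p : nat) : unit_exp R p p = 1.
Proof.
have [->|p_gt0] := posnP p; first exact: unit_exp0.
rewrite /unit_exp mulfK ?pnatr_eq0 -?lt0n // mulr_natl cos2pi.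
by rewrite mulr2n sinDpi sinpi oppr0.
Qed.

Lemma unit_exp_mod (R : realType) (p t : nat) :
  unit_exp R p (t %% p) = unit_exp R p t.
Proof.
rewrite {2}(divn_eq t p) unit_expD; suff -> : unit_exp R p (t %/ p * p) = 1.
  by rewrite mul1r.
by elim: (t %/ p)%N => [|q IHq]; rewrite ?unit_exp0 // mulSn unit_expD IHq
  unit_exp_period mulr1.
Qed.

Lemma unit_exp_conjM (R : realType) (p t : nat) :
  (unit_exp R p t)^* * unit_exp R p t = 1.
Proof.
apply/eqP; rewrite eq_complex /= mulNr opprK -!expr2 cos2Dsin2 eqxx /=.
by rewrite mulNr [X in _ - X]mulrC subrr.
Qed.

(** With [phi] half the angle, the real part is 1 - 2 sin^2 phi, which is less than 1 because 0 <
    phi < pi. *)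
Lemma unit_exp_neq1 (R : realType) (p t : nat) :
  (0 < t < p)%N -> unit_exp R p t != 1.
Proof.
move=> /andP[t_gt0 ltp].
have p_gt0 : (0 < p)%N by apply: leq_ltn_trans ltp.
pose phi : R := pi * t%:R / p%:R.
have sin_phi : 0 < sin phi.
  apply: sin_gt0_pi; rewrite /phi divr_gt0 ?mulr_gt0 ?pi_gt0 ?ltr0n //=.
  by rewrite ltr_pdivrMr ?ltr0n // ltr_pM2l ?pi_gt0 // ltr_nat.
apply/eqP => /(congr1 (@complex.Re R)) /=; apply/eqP.
have -> : 2 * pi * t%:R / p%:R = phi *+ 2 :> R.
  by rewrite /phi -[RHS]mulr_natl !mulrA.
rewrite cos_mulr2n cos2sin2 lt_eqF // mulrnBl addrAC ltrBlDr.
by rewrite mulr2n addrK ltrDl pmulrn_rgt0 // exprn_gt0.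
Qed.

(** * The trace and the additive character of [F] *)

Section AdditiveCharacter.

Variables (R : realType) (F : finFieldType) (p : nat).
Hypothesis charF : p \in [pchar F].

Local Notation Tr := (abs_trace charF).
Local Notation psi := (add_char R charF).
Let p_prime : prime p := pcharf_prime charF.

Lemma abs_trace_is_zmod_morphism : zmod_morphism (abs_trace charF).
Proof. by move=> x y; rewrite /abs_trace !raddfB. Qed.

HB.instance Definition _ :=
  GRing.isZmodMorphism.Build F 'F_p (abs_trace charF) abs_trace_is_zmod_morphism.

(** The map x -> x^p is a Galois automorphism over the prime field, and the trace is Galois
    invariant. *)
Lemma abs_trace_Frobenius (m : nat) (y : F) : Tr (y ^+ (p ^ m)) = Tr y.
Proof.
pose L := pPrimeCharType charF.
have [sigma gen_sigma Dsigma] :=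
  @finField_galois_generator 'F_p L 1%AS {:L}%AS (sub1v _).
have sigmaE (x : L) : sigma x = x ^+ p.
  by rewrite Dsigma ?memvf // dimv1 expn1 card_Fp.
have sigma_gal : sigma \in 'Gal({:L} / 1)%g.
  by move: gen_sigma; rewrite /cyclic.generator => /eqP->; rewrite cycle_id.
have Tr_sigma (x : L) : Tr (sigma x) = Tr x.
  by rewrite /abs_trace galTrace_gal ?memvf.
elim: m => [|m IHm]; first by rewrite expr1.
by rewrite expnSr exprM -[RHS]IHm -[RHS]Tr_sigma sigmaE.
Qed.

(** By independence of automorphisms, their combination with all coefficients 1 is not identically
    zero. *)
Lemma abs_trace_neq0 : exists z : F, Tr z != 0.
Proof.
pose L := pPrimeCharType charF.
have [z _ nz_z] := @gal_independent_contra 'F_p L {:L}%AS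
  [in 'Gal({:L} / 1)%g] (fun=> 1) 1%g (group1 _) (oner_neq0 _).
exists z; apply: contra nz_z => /eqP Trz0.
under eq_bigr do rewrite mul1r.
rewrite -[X in X == _]/(galTrace 1%AS {:L} (z : L)) -abs_traceE Trz0.
by rewrite scale0r.
Qed.

Lemma add_charD (x y : F) : psi (x + y) = psi x * psi y.
Proof.
rewrite /add_char raddfD -unit_expD /=.
(* Addition in ['F_p] reduces the sum of the representatives modulo [p]. *)
by rewrite -[RHS]unit_exp_mod {3}Fp_cast.
Qed.

Lemma add_char_eq (x y : F) : Tr x = Tr y -> psi x = psi y.
Proof. by rewrite /add_char => ->. Qed.

Lemma add_char0 : psi 0 = 1.
Proof. by rewrite /add_char raddf0 unit_exp0. Qed.

Lemma add_char_conjM (x : F) : (psi x)^* * psi x = 1.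
Proof. exact: unit_exp_conjM. Qed.

Lemma add_char_sum (c : F) : c != 0 -> \sum_(x : F) psi (c * x) = 0.
Proof.
move=> nz_c; have [z nz_z] := abs_trace_neq0.
have psi_z : psi z != 1.
  apply: unit_exp_neq1; rewrite lt0n nz_z /=.
  by have := ltn_ord (Tr z); rewrite {2}Fp_cast.
apply: (mulfI (x := psi z - 1)); first by rewrite subr_eq0.
rewrite mulr0 mulrBl mul1r; apply/eqP; rewrite subr_eq0; apply/eqP.
(* Translating x by z / c multiplies the sum by [psi z], which is not 1. *)
rewrite mulr_sumr [RHS](reindex_inj (addrI (z / c))) /=.
by apply: eq_bigr => x _; rewrite mulrDr add_charD mulrCA divff // mulr1.
Qed.

(** Permits reindexing sums over [F] by x -> x^(p^m). *)
Lemma Frobenius_iter_inj (m : nat) : injective (fun x : F => x ^+ (p ^ m)).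
Proof.
elim: m => [|m IHm] x y /=; first by rewrite !expr1.
rewrite expnSr !exprM -!(pFrobenius_autE charF) => eq_xy.
exact/IHm/(fmorph_inj (pFrobenius_aut charF)).
Qed.

(** * Polarization of the form Tr f *)

Section QuadraticForm.

Variables (k : nat) (a : 'I_k.+1 -> F) (alpha : 'I_k.+1 -> nat).
Hypothesis alpha_le : forall i, (alpha i <= alpha ord_max)%N.

Local Notation f := (quad_poly p a alpha).
Local Notation fstar := (quad_poly_star p a alpha).
Local Notation m := (alpha ord_max).

Lemma horner_quad_poly (x : F) :
  f.[x] = \sum_(i < k.+1) a i * (x ^+ (p ^ alpha i) * x).
Proof.
rewrite /quad_poly horner_sum; apply: eq_bigr => i _.
by rewrite !hornerE exprD expr1 /= ?mulrA.
Qed.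

Lemma horner_quad_poly_star (x : F) :
  fstar.[x] = \sum_(i < k.+1)
    (a i ^+ (p ^ m) * x ^+ (p ^ (m + alpha i))
     + a i ^+ (p ^ (m - alpha i)) * x ^+ (p ^ (m - alpha i))).
Proof.
rewrite /quad_poly_star horner_sum; apply: eq_bigr => i _.
by rewrite !hornerE.
Qed.

(* Raising a_i x^(p^alpha_i) y to the power p^m and a_i x y^(p^alpha_i) to the
   power p^(m - alpha_i) keeps their traces and makes y^(p^m) a common factor. *)
Lemma abs_trace_quad_polyD (x y : F) :
  Tr f.[x + y] = Tr f.[x] + Tr f.[y] + Tr (fstar.[x] * y ^+ (p ^ m)).
Proof.
have cross i : Tr ((a i ^+ (p ^ m) * x ^+ (p ^ (m + alpha i))
      + a i ^+ (p ^ (m - alpha i)) * x ^+ (p ^ (m - alpha i))) * y ^+ (p ^ m))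
    = Tr (a i * (x ^+ (p ^ alpha i) * y) + a i * (y ^+ (p ^ alpha i) * x)).
  rewrite mulrDl 2!raddfD /=; congr (_ + _).
    rewrite -[RHS](abs_trace_Frobenius m); congr Tr.
    by rewrite !exprMn -exprM -expnD addnC mulrA.
  rewrite -[RHS](abs_trace_Frobenius (m - alpha i)); congr Tr.
  by rewrite !exprMn -exprM -expnD subnKC ?alpha_le // mulrCA mulrC mulrA.
rewrite !horner_quad_poly horner_quad_poly_star mulr_suml !raddf_sum /=.
rewrite -!big_split /=; apply: eq_bigr => i _.
(* Powers p^alpha_i are additive, so the expansion leaves just these two cross terms. *)
rewrite cross -!raddfD exprDn_pchar ?pnatX ?pnatE ?charF //; congr Tr.
by ring.
Qed.

Lemma abs_trace_quad_poly_star_sym (x y : F) :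
  Tr (fstar.[x] * y ^+ (p ^ m)) = Tr (fstar.[y] * x ^+ (p ^ m)).
Proof.
apply: (addrI (Tr f.[x] + Tr f.[y])).
rewrite -abs_trace_quad_polyD (addrC x) abs_trace_quad_polyD.
by rewrite [Tr f.[x] + _]addrC.
Qed.

(** As [p] is odd, the exponents p^alpha_i + 1 are even and f(-w) = f(w); polarizing f(w - w) then
    gives 0 = 2 Tr f(w). *)
Lemma abs_trace_quad_poly_ker (w : F) :
  odd p -> fstar.[w] = 0 -> Tr f.[w] = 0.
Proof.
move=> p_odd fw0; have := abs_trace_quad_polyD w (- w).
have -> : f.[- w] = f.[w].
  rewrite !horner_quad_poly; apply: eq_bigr => i _.
  by rewrite -!exprSr exprNn -signr_odd /= oddX p_odd orbT mul1r.
rewrite fw0 mul0r [Tr 0]raddf0 addr0 subrr.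
have -> : Tr f.[0] = 0.
  rewrite horner_quad_poly big1 ?raddf0 // => i _.
  by rewrite !mulr0.
move/esym/eqP; rewrite -mulr2n -mulr_natl mulf_eq0 => /orP[|/eqP//].
rewrite -(dvdn_pcharf (pchar_Fp p_prime)) dvdn_prime2 // => /eqP p2.
by rewrite p2 in p_odd.
Qed.

(** * Evaluation of the Weil sums *)

Local Notation S := (weil_sum R charF).

Lemma weil_sum_quad_polyE (b : F) :
  S (f + b *: 'X) = \sum_(x : F) psi f.[x] * psi (b * x).
Proof. by apply: eq_bigr => x _; rewrite !hornerE add_charD. Qed.

(** Applied below with b = 0 at a solution, and with any b at a point of the kernel of f*. *)
Lemma weil_sum_translate (b x0 : F) :
  S (f + b *: 'X) = psi (f.[x0] + b * x0)
    * \sum_(x : F) psi f.[x] * psi (b * x) * psi (fstar.[x0] * x ^+ (p ^ m)).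
Proof.
rewrite weil_sum_quad_polyE (reindex_inj (addrI x0)) mulr_sumr.
apply: eq_bigr => x _; rewrite mulrDr !add_charD.
have -> : psi f.[x0 + x] = psi (f.[x0] + f.[x] + fstar.[x0] * x ^+ (p ^ m)).
  by apply: add_char_eq; rewrite abs_trace_quad_polyD !raddfD.
by rewrite !add_charD; ring.
Qed.

Lemma weil_sum_solution (b x0 : F) : fstar.[x0] = b ^+ (p ^ m) ->
  S (f + b *: 'X) = (psi f.[x0])^* * S f.
Proof.
move=> fx0; have := weil_sum_translate 0 x0.
rewrite scale0r addr0 mul0r addr0 => ->.
rewrite mulrA add_char_conjM mul1r weil_sum_quad_polyE.
apply: eq_bigr => x _; rewrite mul0r add_char0 mulr1; congr (_ * _).
(* Here f*(x0) x^(p^m) = (b x)^(p^m) has the trace of b x. *)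
by apply: add_char_eq; rewrite fx0 -exprMn abs_trace_Frobenius.
Qed.

Lemma weil_sum_ker (b w : F) : odd p -> fstar.[w] = 0 ->
  S (f + b *: 'X) = psi (b * w) * S (f + b *: 'X).
Proof.
move=> p_odd fw0; rewrite {1}(weil_sum_translate b w) add_charD.
have -> : psi f.[w] = 1.
  rewrite -add_char0; apply: add_char_eq.
  by rewrite abs_trace_quad_poly_ker // raddf0.
rewrite mul1r weil_sum_quad_polyE; congr (_ * _).
by apply: eq_bigr => x _; rewrite fw0 mul0r add_char0 mulr1.
Qed.

(* The left side is #|F| times the number of solutions of f*(x) = c. *)
Lemma quad_poly_star_count (c : F) :
  \sum_(x : F) \sum_(u : F) psi ((fstar.[x] - c) * u)
    = #|F|%:R * \sum_(w | fstar.[w] == 0) psi (- (c * w ^+ (p ^ m))).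
Proof.
(* Replacing u by u^(p^m) gives the shape to which the symmetry applies; it moves f* from x to w,
   and the sum over x is then orthogonality. *)
under eq_bigr do rewrite (reindex_inj (@Frobenius_iter_inj m)) /=.
rewrite exchange_big /= mulr_sumr [RHS]big_mkcond; apply: eq_bigr => w _.
transitivity (psi (- (c * w ^+ (p ^ m)))
              * \sum_(x : F) psi (fstar.[w] * x ^+ (p ^ m))).
  rewrite mulr_sumr; apply: eq_bigr => x _.
  rewrite mulrBl add_charD mulrC; congr (_ * _).
  by apply: add_char_eq; apply: abs_trace_quad_poly_star_sym.
case: eqP => [->|/eqP nz_w].
  under eq_bigr do rewrite mul0r add_char0.
  by rewrite sumr_const mulrC.
have := add_char_sum nz_w; rewrite (reindex_inj (@Frobenius_iter_inj m)) /= => ->.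
by rewrite mulr0.
Qed.

Lemma weil_sum_no_solution (b : F) : odd p ->
  (~ exists x0 : F, fstar.[x0] = b ^+ (p ^ m)) -> S (f + b *: 'X) = 0.
Proof.
move=> p_odd no_sol; have := quad_poly_star_count (b ^+ (p ^ m)).
rewrite big1 => [count0|x _]; last first.
  by apply: add_char_sum; rewrite subr_eq0; apply/eqP => fx; case: no_sol; exists x.
set s := S _.
have psi_ker w : fstar.[w] == 0 -> s * psi (- (b ^+ (p ^ m) * w ^+ (p ^ m))) = s.
  move=> /eqP fw0; rewrite {1}/s (weil_sum_ker b p_odd fw0) -/s.
  rewrite mulrAC (@add_char_eq (- _) (- (b * w))); last first.
    by rewrite !raddfN -exprMn /= abs_trace_Frobenius.
  by rewrite -add_charD subrr add_char0 mul1r.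
(* The kernel contains 0, so its cardinality is nonzero in [R[i]], of characteristic 0. *)
have star0 : fstar.[0] == 0.
  rewrite horner_quad_poly_star big1 // => i _.
  by rewrite !expr0n !expn_eq0 eqn0Ngt prime_gt0 //= !mulr0 addr0.
(* Each term of the kernel sum, times [s], equals [s]: the product of #|F|, [s] and the size of the
   kernel is 0. *)
have := congr1 (fun z => s * z) count0; rewrite mulr0 mulrCA mulr_sumr.
rewrite (eq_bigr _ psi_ker) sumr_const -[s *+ _]mulr_natr => /esym/eqP.
rewrite !mulf_eq0 !pnatr_eq0 => /or3P[|/eqP//|].
  by rewrite eqn0Ngt (cardD1 0).
by rewrite eqn0Ngt => /negP[]; apply/card_gt0P; exists 0; apply: star0.
Qed.

End QuadraticForm.

End AdditiveCharacter.

Theorem corollary3p2 (R : realType) (p n : nat) (p_prime : prime p)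
    (p_odd : odd p) (n_ge1 : (1 <= n)%N)
    (F : finFieldType) (charF : p \in [pchar F]) (cardF : #|F| = (p ^ n)%N)
    (k : nat) (a : 'I_k.+1 -> F) (alpha : 'I_k.+1 -> nat)
    (alpha_incr : forall i j : 'I_k.+1, (i < j)%N -> (alpha i < alpha j)%N)
    (a_last : a ord_max != 0) (b : F) :
  let f := quad_poly p a alpha in
  let fstar := quad_poly_star p a alpha in
  let S := weil_sum R charF in
  (forall x0 : F, fstar.[x0] = b ^+ (p ^ alpha ord_max) ->
     S (f + b *: 'X) = (add_char R charF f.[x0])^* * S f)
  /\ ((~ exists x0 : F, fstar.[x0] = b ^+ (p ^ alpha ord_max)) ->
     S (f + b *: 'X) = 0).
Proof.
have alpha_le i : (alpha i <= alpha ord_max)%N.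
  have [->//|ne_i] := eqVneq i ord_max.
  by apply/ltnW/alpha_incr; rewrite ltn_neqAle ne_i leq_ord.
split=> [x0|]; first exact: weil_sum_solution.
exact: weil_sum_no_solution.
Qed.
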